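(* Let $k$ be a field of characteristic $0$, let $\mathrm{DerPerm}\langle X\rangle$ be the free differential perm algebra on $X$ over $k$, and endow it with the bilinear product $a\bullet b:=a'b+ab'$. Put $(x,y,z)_{\bullet}=(x\bullet y)\bullet z-x\bullet(y\bullet z)$. Then $(\mathrm{DerPerm}\langle X\rangle,\bullet)$ satisfies, for all elements $a,b,c,d$, the left-commutative identity $$(a\bullet b)\bullet c=(b\bullet a)\bullet c,$$ and the following two Tortken di-identities: $$(a\bullet b)\bullet (c\bullet d)-(c\bullet b)\bullet(a\bullet d)+(a,b,c)_{\bullet}\bullet d+b\bullet\bigl(a\bullet(c\bullet d)-c\bullet(a\bullet d)\bigr)=0,$$ $$(a\bullet b)\bullet (c\bullet d)-(a\bullet c)\bullet (b\bullet d)-b\bullet(a,c,d)_{\bullet}+c\bullet(a,b,d)_{\bullet}=0.$$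
   Context: A perm algebra is an associative algebra satisfying $(ab)c=(ba)c$. A differential perm algebra is a perm algebra equipped with a derivation; here the derivation of an element $a$ is written $a'$ (the letter $d$ in the identities denotes an arbitrary element, not the derivation). The free differential perm algebra $\mathrm{DerPerm}\langle X\rangle$ on $X=\{x_1,x_2,\dots\}$ is the free perm algebra generated by the symbols $x^{(s)}$ ($x\in X$, $s\ge 0$, $x^{(0)}=x$) with the derivation determined by $(x^{(s)})'=x^{(s+1)}$ and the Leibniz rule. *)

(* Defs.v *)
From HB Require Import structures.
From mathcomp Require Import all_boot all_algebra.
From mathcomp Require Import boolp.

Set Implicit Arguments.
Unset Strict Implicit.
Unset Printing Implicit Defensive.

Import GRing.Theory.
Local Open Scope ring_scope.
Local Open Scope quotient_scope.

Declare Scope perm_scope.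
Delimit Scope perm_scope with perm.
Reserved Notation "a ∘ b" (at level 40, left associativity).
Reserved Notation "a • b" (at level 40, left associativity).

(* Associative algebras are not assumed to be unital. *)
HB.mixin Record Lmodule_isPermAlgebra (k : fieldType) A of GRing.Lmodule k A := {
  pmul : A -> A -> A;
  pmulDl : left_distributive pmul +%R;
  pmulDr : right_distributive pmul +%R;
  pmulZl : forall (t : k) (a b : A), pmul (t *: a) b = t *: pmul a b;
  pmulZr : forall (t : k) (a b : A), pmul a (t *: b) = t *: pmul a b;
  pmulA : associative pmul;
  pmulLC : forall a b c : A, pmul (pmul a b) c = pmul (pmul b a) c
}.

#[short(type="permAlgType")]
HB.structure Definition PermAlgebra (k : fieldType) :=
  { A of GRing.Lmodule k A & Lmodule_isPermAlgebra k A }.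

Notation "a ∘ b" := (pmul a b) : perm_scope.
Local Open Scope perm_scope.

HB.mixin Record PermAlgebra_hasDerivation (k : fieldType) A
    of PermAlgebra k A := {
  der : A -> A;
  derD : forall a b : A, der (a + b) = der a + der b;
  derZ : forall (t : k) (a : A), der (t *: a) = t *: der a;
  derM : forall a b : A, der (a ∘ b) = der a ∘ b + a ∘ der b
}.

#[short(type="diffPermAlgType")]
HB.structure Definition DiffPermAlgebra (k : fieldType) :=
  { A of PermAlgebra k A & PermAlgebra_hasDerivation k A }.

Notation "a ^'" := (der a) : perm_scope.

Definition bullet (k : fieldType) (A : diffPermAlgType k) (a b : A) : A :=
  a^' ∘ b + a ∘ b^'.

Notation "a • b" := (bullet a b) : perm_scope.

Definition assoc_bullet (k : fieldType) (A : diffPermAlgType k)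
    (x y z : A) : A :=
  (x • y) • z - x • (y • z).

(* The free perm algebra on Y: nonassociative algebra terms over Y modulo the
   least congruence containing the axioms of perm algebras. *)
Section FreePerm.
Variables (k : fieldType) (Y : Type).

Inductive term : Type :=
  | Var of Y
  | Zero
  | Opp of term
  | Add of term & term
  | Scale of k & term
  | Mul of term & term.

Inductive perm_eq_term : term -> term -> Prop :=
  | pe_refl u : perm_eq_term u u
  | pe_sym u v : perm_eq_term u v -> perm_eq_term v u
  | pe_trans u v w :
      perm_eq_term u v -> perm_eq_term v w -> perm_eq_term u w
  | pe_Opp u v : perm_eq_term u v -> perm_eq_term (Opp u) (Opp v)
  | pe_Add u u' v v' : perm_eq_term u u' -> perm_eq_term v v' ->
      perm_eq_term (Add u v) (Add u' v')
  | pe_Scale t u v :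
      perm_eq_term u v -> perm_eq_term (Scale t u) (Scale t v)
  | pe_Mul u u' v v' : perm_eq_term u u' -> perm_eq_term v v' ->
      perm_eq_term (Mul u v) (Mul u' v')
  | pe_addA u v w : perm_eq_term (Add u (Add v w)) (Add (Add u v) w)
  | pe_addC u v : perm_eq_term (Add u v) (Add v u)
  | pe_add0 u : perm_eq_term (Add Zero u) u
  | pe_addN u : perm_eq_term (Add (Opp u) u) Zero
  | pe_scaleA s t u :
      perm_eq_term (Scale s (Scale t u)) (Scale (s * t) u)
  | pe_scale1 u : perm_eq_term (Scale 1 u) u
  | pe_scaleDr t u v :
      perm_eq_term (Scale t (Add u v)) (Add (Scale t u) (Scale t v))
  | pe_scaleDl u s t :
      perm_eq_term (Scale (s + t) u) (Add (Scale s u) (Scale t u))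
  | pe_mulDl u v w :
      perm_eq_term (Mul (Add u v) w) (Add (Mul u w) (Mul v w))
  | pe_mulDr u v w :
      perm_eq_term (Mul u (Add v w)) (Add (Mul u v) (Mul u w))
  | pe_mulZl t u v : perm_eq_term (Mul (Scale t u) v) (Scale t (Mul u v))
  | pe_mulZr t u v : perm_eq_term (Mul u (Scale t v)) (Scale t (Mul u v))
  | pe_mulA u v w : perm_eq_term (Mul u (Mul v w)) (Mul (Mul u v) w)
  | pe_mulLC u v w : perm_eq_term (Mul (Mul u v) w) (Mul (Mul v u) w).

HB.instance Definition _ := gen_eqMixin term.
HB.instance Definition _ := gen_choiceMixin term.

Definition perm_eqb : rel term := fun u v => `[< perm_eq_term u v >].

Lemma perm_eqb_refl : reflexive perm_eqb.
Proof. by move=> u; apply/asboolP; exact: pe_refl. Qed.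

Lemma perm_eqb_sym : symmetric perm_eqb.
Proof. by move=> u v; apply/asboolP/asboolP => /pe_sym. Qed.

Lemma perm_eqb_trans : transitive perm_eqb.
Proof.
move=> v u w /asboolP uv /asboolP vw; apply/asboolP; exact: pe_trans uv vw.
Qed.

Canonical perm_equiv :=
  EquivRel perm_eqb perm_eqb_refl perm_eqb_sym perm_eqb_trans.

Definition FreePerm : Type := {eq_quot perm_equiv}.

HB.instance Definition _ := Choice.on FreePerm.

Definition cls (u : term) : FreePerm := \pi_({eq_quot perm_equiv}) u.
Definition rep (a : FreePerm) : term := repr (a : {eq_quot perm_equiv}).

Lemma repK : cancel rep cls.
Proof. by move=> a; exact: reprK. Qed.

Lemma clsP u v : cls u = cls v <-> perm_eq_term u v.
Proof.
split=> [/eqmodP /asboolP //|uv].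
by apply/eqmodP; apply/asboolP.
Qed.

Lemma rep_cls u : perm_eq_term (rep (cls u)) u.
Proof. by apply/clsP; rewrite repK. Qed.

Definition gen (y : Y) : FreePerm := cls (Var y).

Definition fzero : FreePerm := cls Zero.
Definition fopp (a : FreePerm) : FreePerm := cls (Opp (rep a)).
Definition fadd (a b : FreePerm) : FreePerm := cls (Add (rep a) (rep b)).
Definition fscale (t : k) (a : FreePerm) : FreePerm := cls (Scale t (rep a)).
Definition fmul (a b : FreePerm) : FreePerm := cls (Mul (rep a) (rep b)).

Lemma foppE u : fopp (cls u) = cls (Opp u).
Proof. by apply/clsP/pe_Opp/rep_cls. Qed.

Lemma faddE u v : fadd (cls u) (cls v) = cls (Add u v).
Proof. by apply/clsP/pe_Add; exact: rep_cls. Qed.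

Lemma fscaleE t u : fscale t (cls u) = cls (Scale t u).
Proof. by apply/clsP/pe_Scale/rep_cls. Qed.

Lemma fmulE u v : fmul (cls u) (cls v) = cls (Mul u v).
Proof. by apply/clsP/pe_Mul; exact: rep_cls. Qed.

Let fE := (foppE, faddE, fscaleE, fmulE).

Lemma faddA : associative fadd.
Proof.
move=> a b c; rewrite -(repK a) -(repK b) -(repK c) !fE.
by apply/clsP; constructor.
Qed.

Lemma faddC : commutative fadd.
Proof.
by move=> a b; rewrite -(repK a) -(repK b) !fE; apply/clsP; constructor.
Qed.

Lemma fadd0 : left_id fzero fadd.
Proof. by move=> a; rewrite -(repK a) !fE; apply/clsP; constructor. Qed.

Lemma faddN : left_inverse fzero fopp fadd.
Proof. by move=> a; rewrite -(repK a) !fE; apply/clsP; constructor. Qed.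

HB.instance Definition _ :=
  GRing.isZmodule.Build FreePerm faddA faddC fadd0 faddN.

Lemma fscaleA s t a : fscale s (fscale t a) = fscale (s * t) a.
Proof. by rewrite -(repK a) !fE; apply/clsP; constructor. Qed.

Lemma fscale1 : left_id 1 fscale.
Proof. by move=> a; rewrite -(repK a) !fE; apply/clsP; constructor. Qed.

Lemma fscaleDr : right_distributive fscale +%R.
Proof.
move=> t a b; rewrite -(repK a) -(repK b) /GRing.add /= !fE.
by apply/clsP; constructor.
Qed.

Lemma fscaleDl a : {morph fscale^~ a : s t / s + t}.
Proof.
move=> s t; rewrite -(repK a) [in RHS]/GRing.add /= !fE.
by apply/clsP; constructor.
Qed.

HB.instance Definition _ := GRing.Zmodule_isLmodule.Build k FreePerm
  fscaleA fscale1 fscaleDr fscaleDl.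

Lemma clsD u v : cls (Add u v) = cls u + cls v.
Proof. by rewrite -faddE. Qed.

Lemma clsN u : cls (Opp u) = - cls u.
Proof. by rewrite -foppE. Qed.

Lemma clsZ t u : cls (Scale t u) = t *: cls u.
Proof. by rewrite -fscaleE. Qed.

Lemma cls0 : cls Zero = 0.
Proof. by []. Qed.

Lemma fmulDl : left_distributive fmul +%R.
Proof.
move=> a b c; rewrite -(repK a) -(repK b) -(repK c) -clsD !fE -clsD.
by apply/clsP; constructor.
Qed.

Lemma fmulDr : right_distributive fmul +%R.
Proof.
move=> a b c; rewrite -(repK a) -(repK b) -(repK c) -clsD !fE -clsD.
by apply/clsP; constructor.
Qed.

Lemma fmulZl t a b : fmul (t *: a) b = t *: fmul a b.
Proof.
rewrite -(repK a) -(repK b) -clsZ !fE -clsZ.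
by apply/clsP; constructor.
Qed.

Lemma fmulZr t a b : fmul a (t *: b) = t *: fmul a b.
Proof.
rewrite -(repK a) -(repK b) -clsZ !fE -clsZ.
by apply/clsP; constructor.
Qed.

Lemma fmulA : associative fmul.
Proof.
move=> a b c; rewrite -(repK a) -(repK b) -(repK c) !fE.
by apply/clsP; constructor.
Qed.

Lemma fmulLC a b c : fmul (fmul a b) c = fmul (fmul b a) c.
Proof.
rewrite -(repK a) -(repK b) -(repK c) !fE.
by apply/clsP; constructor.
Qed.

HB.instance Definition _ := Lmodule_isPermAlgebra.Build k FreePerm
  fmulDl fmulDr fmulZl fmulZr fmulA fmulLC.

Lemma clsM u v : cls (Mul u v) = cls u ∘ cls v.
Proof. by rewrite -fmulE. Qed.

Fixpoint eval_term (A : permAlgType k) (f : Y -> A) (u : term) : A :=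
  match u with
  | Var y => f y
  | Zero => 0
  | Opp v => - eval_term f v
  | Add v w => eval_term f v + eval_term f w
  | Scale t v => t *: eval_term f v
  | Mul v w => eval_term f v ∘ eval_term f w
  end.

Lemma eval_termP (A : permAlgType k) (f : Y -> A) u v :
  perm_eq_term u v -> eval_term f u = eval_term f v.
Proof.
elim=> {u v} //=.
- by move=> u v w _ -> _ ->.
- by move=> u v _ ->.
- by move=> u u' v v' _ -> _ ->.
- by move=> t u v _ ->.
- by move=> u u' v v' _ -> _ ->.
- by move=> u v w; rewrite addrA.
- by move=> u v; rewrite addrC.
- by move=> u; rewrite add0r.
- by move=> u; rewrite addNr.
- by move=> s t u; rewrite scalerA.
- by move=> u; rewrite scale1r.
- by move=> t u v; rewrite scalerDr.
- by move=> u s t; rewrite scalerDl.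
- by move=> u v w; rewrite pmulDl.
- by move=> u v w; rewrite pmulDr.
- by move=> t u v; rewrite pmulZl.
- by move=> t u v; rewrite pmulZr.
- by move=> u v w; rewrite pmulA.
- by move=> u v w; rewrite pmulLC.
Qed.

Definition eval_free (A : permAlgType k) (f : Y -> A) (a : FreePerm) : A :=
  eval_term f (rep a).

Lemma eval_freeE (A : permAlgType k) (f : Y -> A) u :
  eval_free f (cls u) = eval_term f u.
Proof. exact: eval_termP (rep_cls u). Qed.

Lemma eval_free_linear (A : permAlgType k) (f : Y -> A) :
  linear (eval_free f).
Proof.
move=> t a b; rewrite -(repK a) -(repK b) -clsZ -clsD.
by rewrite !eval_freeE.
Qed.

HB.instance Definition _ (A : permAlgType k) (f : Y -> A) :=
  GRing.isLinear.Build k FreePerm A *:%R (eval_free f) (eval_free_linear f).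

Lemma eval_freeM (A : permAlgType k) (f : Y -> A) :
  {morph eval_free f : a b / a ∘ b}.
Proof.
move=> a b; rewrite -(repK a) -(repK b) -clsM.
by rewrite !eval_freeE.
Qed.

Lemma eval_free_gen (A : permAlgType k) (f : Y -> A) y :
  eval_free f (gen y) = f y.
Proof. exact: eval_freeE. Qed.

Theorem FreePerm_universal (A : permAlgType k) (f : Y -> A) :
  exists phi : {linear FreePerm -> A},
    [/\ {morph phi : a b / a ∘ b},
        forall y, phi (gen y) = f y
      & forall psi : {linear FreePerm -> A},
          {morph psi : a b / a ∘ b} -> (forall y, psi (gen y) = f y) ->
          psi =1 phi].
Proof.
exists (eval_free f); split=> [||psi psiM psig a].
- exact: eval_freeM.
- exact: eval_free_gen.
rewrite -(repK a) /= eval_freeE.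
elim: (rep a) => /= [y||u <-|u <- v <-|t u <-|u <- v <-].
- exact: psig.
- by rewrite cls0 linear0.
- by rewrite clsN linearN.
- by rewrite clsD linearD.
- by rewrite clsZ linearZ.
- by rewrite clsM psiM.
Qed.

End FreePerm.

Arguments gen {k Y} y.

Section DerPerm.
Variables (k : fieldType) (X : Type).

(* The pair (x, s) stands for the symbol x^(s). *)
Definition DerPerm : Type := FreePerm k (X * nat).

HB.instance Definition _ := PermAlgebra.on DerPerm.

Definition dgen (x : X) (s : nat) : DerPerm := gen (x, s).

Fixpoint der_term (u : term k (X * nat)) : term k (X * nat) :=
  match u with
  | Var (x, s) => Var k (x, s.+1)
  | Zero => Zero k _
  | Opp v => Opp (der_term v)
  | Add v w => Add (der_term v) (der_term w)
  | Scale t v => Scale t (der_term v)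
  | Mul v w => Add (Mul (der_term v) w) (Mul v (der_term w))
  end.

Definition der_free (a : DerPerm) : DerPerm := cls (der_term (rep a)).

Let clsE := (@clsD k (X * nat), @clsN k (X * nat), @clsZ k (X * nat),
             @clsM k (X * nat), @cls0 k (X * nat)).

Lemma der_termP u v : perm_eq_term u v ->
  cls (der_term u) = cls (der_term v) :> DerPerm.
Proof.
elim=> {u v} //=.
- by move=> u v w _ -> _ ->.
- by move=> u v _; rewrite !clsE => ->.
- by move=> u u' v v' _ + _; rewrite !clsE => -> ->.
- by move=> t u v _; rewrite !clsE => ->.
- by move=> u u' v v' /clsP eu + /clsP ev; rewrite !clsE eu ev => -> ->.
- by move=> u v w; rewrite !clsE addrA.
- by move=> u v; rewrite !clsE addrC.
- by move=> u; rewrite !clsE add0r.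
- by move=> u; rewrite !clsE addNr.
- by move=> s t u; rewrite !clsE scalerA.
- by move=> u; rewrite !clsE scale1r.
- by move=> t u v; rewrite !clsE scalerDr.
- by move=> u s t; rewrite !clsE scalerDl.
- by move=> u v w; rewrite !clsE !pmulDl addrACA.
- by move=> u v w; rewrite !clsE !pmulDr addrACA.
- by move=> t u v; rewrite !clsE !pmulZl -scalerDr.
- by move=> t u v; rewrite !clsE !pmulZr -scalerDr.
- by move=> u v w; rewrite !clsE !pmulDl !pmulDr !pmulA addrA.
- move=> u v w; rewrite !clsE !pmulDl.
  rewrite (pmulLC (cls (der_term u))) (pmulLC (cls u)) (pmulLC (cls u)).
  by congr (_ + _); rewrite addrC.
Qed.

Lemma der_freeE (u : term k (X * nat)) :
  der_free (cls u) = cls (der_term u).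
Proof. exact: der_termP (rep_cls u). Qed.

Lemma der_freeD (a b : DerPerm) :
  der_free (a + b) = der_free a + der_free b.
Proof.
by rewrite -(repK a) -(repK b) -clsD !der_freeE /= clsD.
Qed.

Lemma der_freeZ (t : k) (a : DerPerm) : der_free (t *: a) = t *: der_free a.
Proof. by rewrite -(repK a) -clsZ !der_freeE /= clsZ. Qed.

Lemma der_freeM (a b : DerPerm) :
  der_free (a ∘ b) = der_free a ∘ b + a ∘ der_free b.
Proof.
by rewrite -(repK a) -(repK b) -clsM !der_freeE /= clsD !clsM.
Qed.

HB.instance Definition _ := PermAlgebra_hasDerivation.Build k DerPerm
  der_freeD der_freeZ der_freeM.

Lemma der_cls (u : term k (X * nat)) :
  (cls u : DerPerm)^' = cls (der_term u).
Proof. exact: der_freeE. Qed.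

Lemma der_dgen x s : (dgen x s)^' = dgen x s.+1.
Proof. exact: der_freeE. Qed.

Theorem DerPerm_universal (A : diffPermAlgType k) (f : X -> A) :
  exists phi : {linear DerPerm -> A},
    [/\ {morph phi : a b / a ∘ b},
        {morph phi : a / a^'},
        forall x, phi (dgen x 0) = f x
      & forall psi : {linear DerPerm -> A},
          {morph psi : a b / a ∘ b} -> {morph psi : a / a^'} ->
          (forall x, psi (dgen x 0) = f x) -> psi =1 phi].
Proof.
have [phi [phiM phig phiU]] :=
  @FreePerm_universal k (X * nat)%type A (fun xs => iter xs.2 der (f xs.1)).
have der0 : (0 : A)^' = 0 by have := derZ (0 : k) (0 : A); rewrite !scale0r.
have derN (a : A) : (- a)^' = - a^' by rewrite -scaleN1r derZ scaleN1r.
exists phi; split=> [|a|x|psi psiM psid psig].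
- exact: phiM.
- rewrite -(repK a) der_cls.
  elim: (rep a) => [[x s]||u IH|u IHu v IHv|t u IH|u IHu v IHv] /=.
  + by rewrite !(phig (_, _)).
  + by rewrite cls0 linear0 der0.
  + by rewrite !clsN !linearN IH derN.
  + by rewrite !clsD !linearD IHu IHv derD.
  + by rewrite !clsZ !linearZ IH derZ.
  + by rewrite clsD !clsM linearD !phiM IHu IHv derM.
- exact: phig.
- apply: phiU => // -[x s] /=; elim: s => [|s IH]; first exact: psig.
  by rewrite -[gen _]/(dgen x s.+1) -der_dgen psid IH.
Qed.

End DerPerm.

(* Main.v *)
(* By the Leibniz rule [a • b] is the derivative of [a ∘ b], so the left-hand
   side of each Tortken di-identity is the derivative of an expression with
   only two derivations.  Left multiplications commute in a perm algebra, so
   the monomials of that expression can be sorted; they cancel in pairs. *)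
Require Import Defs.
From mathcomp Require Import all_boot all_algebra.

Import GRing.Theory.
Local Open Scope ring_scope.
Local Open Scope perm_scope.

Section BulletIdentities.
Context {k : fieldType} {A : diffPermAlgType k}.
Implicit Types a b c d : A.

Lemma pmulCA a b c : a ∘ (b ∘ c) = b ∘ (a ∘ c).
Proof. by rewrite !pmulA pmulLC. Qed.

Lemma derN a : (- a)^' = - a^'.
Proof. by rewrite -scaleN1r derZ scaleN1r. Qed.

Lemma derB a b : (a - b)^' = a^' - b^'.
Proof. by rewrite derD derN. Qed.

Lemma der0 : (0 : A)^' = 0.
Proof. by rewrite -(scale0r (0 : A)) derZ !scale0r. Qed.

Lemma pmulNr a b : a ∘ (- b) = - (a ∘ b).
Proof. by rewrite -scaleN1r pmulZr scaleN1r. Qed.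

Lemma pmulNl a b : (- a) ∘ b = - (a ∘ b).
Proof. by rewrite -scaleN1r pmulZl scaleN1r. Qed.

Lemma pmulBr a b c : a ∘ (b - c) = a ∘ b - a ∘ c.
Proof. by rewrite pmulDr pmulNr. Qed.

Lemma pmulBl a b c : (a - b) ∘ c = a ∘ c - b ∘ c.
Proof. by rewrite pmulDl pmulNl. Qed.

Lemma bulletE a b : a • b = (a ∘ b)^'.
Proof. by rewrite derM. Qed.

(** Both sides are derivatives; under the outer derivation, left-commutativity turns each Leibniz
    term of one side into the other Leibniz term of the other side. *)
Lemma bullet_leftC a b c : (a • b) • c = (b • a) • c.
Proof.
rewrite !bulletE; congr (_^').
by rewrite !derM !pmulDl (pmulLC a^') (pmulLC a) addrC.
Qed.

(** Terms cancel twice: [a ∘ (b^' ∘ c)] under the outer derivation, then [a^' ∘ (b ∘ c^')] once it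
    is applied. *)
Lemma assoc_bulletE a b c :
  assoc_bullet a b c = (a^'^' ∘ (b ∘ c) - a ∘ (b ∘ c^'^'))
                     + (a^' ∘ (b^' ∘ c) - a ∘ (b^' ∘ c^')).
Proof.
rewrite /assoc_bullet !bulletE -derB.
have -> : (a ∘ b)^' ∘ c - a ∘ (b ∘ c)^' = a^' ∘ (b ∘ c) - a ∘ (b ∘ c^').
  by rewrite !derM pmulDl pmulDr -!pmulA opprD addrA addrK.
rewrite derB !derM !pmulDr addrA opprD addrA addrK.
by rewrite [X in _ - X]addrC opprD addrACA.
Qed.

(** Again two cancellations: [a ∘ (c ∘ d^')] under the outer derivation, then [a^' ∘ (c^' ∘ d)]. *)
Lemma bullet_altE a c d :
  a • (c • d) - c • (a • d) = (a ∘ (c^'^' ∘ d) - a^'^' ∘ (c ∘ d))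
                            + (a ∘ (c^' ∘ d^') - a^' ∘ (c ∘ d^')).
Proof.
rewrite !bulletE -derB !derM.
rewrite !pmulDr (pmulCA c a^') (pmulCA c a) opprD addrACA subrr addr0.
rewrite derB !derM !pmulDr [X in _ - X]addrCA opprD addrACA subrr add0r.
by rewrite opprD addrACA.
Qed.

(** The grouping serves both identities: the first bracket is symmetric in [a] and [c], the second
    in [b] and [c], so each antisymmetrization kills one bracket. *)
Lemma pmul_derM a b c d :
  (a ∘ b)^' ∘ (c ∘ d)^' = (a^' ∘ (b ∘ (c^' ∘ d)) + a ∘ (b^' ∘ (c ∘ d^')))
                        + (a^' ∘ (b ∘ (c ∘ d^')) + a ∘ (b^' ∘ (c^' ∘ d))).
Proof.
rewrite !derM pmulDl !pmulDr -!pmulA addrACA [X in _ + X]addrC.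
by rewrite addrACA [X in _ + X]addrC.
Qed.

Lemma pmul_rev a b c d : a ∘ (b ∘ (c ∘ d)) = c ∘ (b ∘ (a ∘ d)).
Proof. by rewrite (pmulCA b c) pmulCA (pmulCA a b). Qed.

Lemma bullet_tortken1 a b c d :
  (a • b) • (c • d) - (c • b) • (a • d) + assoc_bullet a b c • d
    + b • (a • (c • d) - c • (a • d)) = 0.
Proof.
have -> : (a • b) • (c • d) - (c • b) • (a • d)
    = ((a^' ∘ (b ∘ (c ∘ d^')) - a ∘ (b ∘ (c^' ∘ d^')))
       + (a ∘ (b^' ∘ (c^' ∘ d)) - a^' ∘ (b^' ∘ (c ∘ d))))^'.
  rewrite 2!(bulletE (_ • _)) -derB !bulletE; congr (_^').
  rewrite !pmul_derM !(pmul_rev c) !(pmul_rev c^').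
  by rewrite opprD addrACA subrr add0r opprD addrACA.
(* Writing 0 as a derivative reduces the claim to an identity under the outer derivation. *)
rewrite bullet_altE assoc_bulletE !bulletE -!derD -[RHS]der0; congr (_^').
rewrite pmulDl pmulDr !pmulBl !pmulBr -!pmulA.
rewrite !(pmulCA b a) (pmulCA b a^'^') (pmulCA b a^').
set r := a^' ∘ (b ∘ (c ∘ d^')); set t := a ∘ (b ∘ (c^' ∘ d^')).
set s := a ∘ (b^' ∘ (c^' ∘ d)); set u := a^' ∘ (b^' ∘ (c ∘ d)).
set v := a^'^' ∘ _; set w := a ∘ (b ∘ _).
(* The products contribute [x + y], the associator term [z - y], and the last term [- z - x]. *)
rewrite -(opprB s u) -(opprB r t) -(opprB v w).
move: (r - t) (s - u) (v - w) => x y z.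
by rewrite (addrC z) (addrA (x + y)) addrK -opprD (addrC z x) subrr.
Qed.

Lemma bullet_tortken2 a b c d :
  (a • b) • (c • d) - (a • c) • (b • d) - b • assoc_bullet a c d
    + c • assoc_bullet a b d = 0.
Proof.
have -> : (a • b) • (c • d) - (a • c) • (b • d)
    = ((a^' ∘ (b ∘ (c^' ∘ d)) - a ∘ (b ∘ (c^' ∘ d^')))
       - (a^' ∘ (b^' ∘ (c ∘ d)) - a ∘ (b^' ∘ (c ∘ d^'))))^'.
  rewrite 2!(bulletE (_ • _)) -derB !bulletE; congr (_^').
  rewrite !pmul_derM (pmulCA c b^') !(pmulCA c^') (pmulCA c b).
  rewrite opprD addrACA subrr addr0.
  by rewrite [X in _ - X]addrC opprD addrACA opprB.
rewrite !assoc_bulletE !bulletE -derB -derD -[RHS]der0; congr (_^').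
rewrite !pmulDr !pmulNr (pmulCA b a^'^') (pmulCA b a^') !(pmulCA b a).
rewrite !(pmulCA c a^'^') !(pmulCA c a^') !(pmulCA c a) !(pmulCA c b).
rewrite !(pmulCA c b^').
(* Here [e] is [a^'^' ∘ (b ∘ (c ∘ d)) - a ∘ (b ∘ (c ∘ d^'^'))], symmetric in [b] and [c] and hence
   shared by both associator terms. *)
have cancel (x y e : A) : x - y - (e + x) + (e + y) = 0.
  by rewrite (addrC e x) opprD (addrACA x) subrr add0r -opprD (addrC y) addNr.
exact: cancel.
Qed.

End BulletIdentities.

Theorem proposition5p1 (k : fieldType) (char0 : [pchar k] =i pred0) :
  (forall a b c : DerPerm k nat, (a • b) • c = (b • a) • c) /\
  (forall a b c d : DerPerm k nat,
     (a • b) • (c • d) - (c • b) • (a • d) + assoc_bullet a b c • d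
       + b • (a • (c • d) - c • (a • d)) = 0) /\
  (forall a b c d : DerPerm k nat,
     (a • b) • (c • d) - (a • c) • (b • d) - b • assoc_bullet a c d
       + c • assoc_bullet a b d = 0).
Proof.
split; first exact: bullet_leftC.
by split; [exact: bullet_tortken1 | exact: bullet_tortken2].
Qed.
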